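(* Let $P_1,\dots,P_5\in\mathbb{P}^2_{\mathbb{C}}$ be a $V$-configuration such that $\operatorname{rk}\Phi(P_1,\dots,P_5)=9$ and $\delta_2(P_1,\dots,P_5)=0$. Let $V(f)$ be the (unique) cubic having $P_1,\dots,P_5$ among its eigenpoints, and suppose that $E(f)$ is regular. Then the two other eigenpoints of $f$ (those different from $P_1,\dots,P_5$) are aligned with $P_1$.
   Context: Work in $\mathbb{P}^2_{\mathbb{C}}$. For a nonzero ternary cubic form $f$ over $\mathbb{C}$ let $g_1=x\partial_yf-y\partial_xf$, $g_2=x\partial_zf-z\partial_xf$, $g_3=y\partial_zf-z\partial_yf$. The eigenscheme $E(f)\subset\mathbb{P}^2$ is the subscheme defined by $g_1,g_2,g_3$; its points are the eigenpoints of $f$. $E(f)$ is called regular if it is reduced of dimension $0$; it then consists of exactly $7$ points. For $P=(A:B:C)$, $\Phi(P)$ is the $3\times10$ matrix such that $\Phi(P)\,w_f=(g_1(P),g_2(P),g_3(P))^{T}$ for every cubic $f$, where $w_f\in\mathbb{C}^{10}$ is the vector of coefficients of $f$ in the monomial basis $x^3,x^2y,xy^2,y^3,x^2z,xyz,y^2z,xz^2,yz^2,z^3$. $\Phi(P_1,\dots,P_n)$ is obtained by stacking $\Phi(P_1),\dots,\Phi(P_n)$. A $V$-configuration is a tuple of five distinct points $P_1,\dots,P_5$ such that $P_1,P_2,P_3$ are aligned, $P_1,P_4,P_5$ are aligned, and $P_1,P_2,P_4$ are not aligned. With $s_{ij}=\langle P_i,P_j\rangle$, where $\langle (A,B,C),(A',B',C')\rangle=AA'+BB'+CC'$,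 define $\delta_2(P_1,\dots,P_5)=s_{12}s_{13}s_{45}-s_{14}s_{15}s_{23}$. *)

(* Defs.v *)
From HB Require Import structures.
From mathcomp Require Import all_boot all_order all_algebra.
From mathcomp Require Import reals complex mpoly.

Set Implicit Arguments.
Unset Strict Implicit.
Unset Printing Implicit Defensive.

Import GRing.Theory.
Local Open Scope ring_scope.

(* A point of the projective plane over F is given by a nonzero row vector of
   homogeneous coordinates; two such vectors represent the same point when they
   span the same line of F^3. *)
Definition same_point (F : fieldType) (P Q : 'rV[F]_3) : bool := (P == Q)%MS.

Definition aligned (F : fieldType) (P Q S : 'rV[F]_3) : Prop :=
  exists l : 'cV[F]_3,
    [/\ l != 0, P *m l = 0, Q *m l = 0 & S *m l = 0].

Definition V_configuration (F : fieldType) (P1 P2 P3 P4 P5 : 'rV[F]_3) : Prop :=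
  let P := [:: P1; P2; P3; P4; P5] in
  [/\ all (fun Q => Q != 0) P,
      pairwise (fun Q S => ~~ same_point Q S) P,
      aligned P1 P2 P3,
      aligned P1 P4 P5
    & ~ aligned P1 P2 P4].

Definition bil (F : fieldType) (P Q : 'rV[F]_3) : F :=
  \sum_(k < 3) P 0 k * Q 0 k.

Definition delta2 (F : fieldType) (P1 P2 P3 P4 P5 : 'rV[F]_3) : F :=
  bil P1 P2 * bil P1 P3 * bil P4 P5 - bil P1 P4 * bil P1 P5 * bil P2 P3.

(* Indices of the variables x, y, z of {mpoly F[3]}. *)
Definition ix : 'I_3 := @Ordinal 3 0 isT.
Definition iy : 'I_3 := @Ordinal 3 1 isT.
Definition iz : 'I_3 := @Ordinal 3 2 isT.

(* eigenform f 0, eigenform f 1, eigenform f 2 are g_1, g_2, g_3. *)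
Definition eigenform (F : fieldType) (f : {mpoly F[3]}) (k : 'I_3) :
    {mpoly F[3]} :=
  tnth [tuple 'X_ix * f^`M(iy) - 'X_iy * f^`M(ix);
              'X_ix * f^`M(iz) - 'X_iz * f^`M(ix);
              'X_iy * f^`M(iz) - 'X_iz * f^`M(iy)] k.

Definition eigenpoint (F : fieldType) (f : {mpoly F[3]}) (P : 'rV[F]_3) : Prop :=
  P != 0 /\ forall k, (eigenform f k).@[P 0] = 0.

(* x^3, x^2y, xy^2, y^3, x^2z, xyz, y^2z, xz^2, yz^2, z^3. *)
Definition cubic_monomials : 10.-tuple 'X_{1..3} :=
  [tuple [multinom [tuple 3; 0; 0]]; [multinom [tuple 2; 1; 0]];
         [multinom [tuple 1; 2; 0]]; [multinom [tuple 0; 3; 0]];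
         [multinom [tuple 2; 0; 1]]; [multinom [tuple 1; 1; 1]];
         [multinom [tuple 0; 2; 1]]; [multinom [tuple 1; 0; 2]];
         [multinom [tuple 0; 1; 2]]; [multinom [tuple 0; 0; 3]]]%N.

Definition cubic_coefs (F : fieldType) (f : {mpoly F[3]}) : 'cV[F]_10 :=
  \col_j f@_(tnth cubic_monomials j).

(* By linearity of f |-> g_k, the j-th column of Phi(P) has to consist of the
   values at P of the g_k of the j-th monomial; see PhiE. *)
Definition Phi (F : fieldType) (P : 'rV[F]_3) : 'M[F]_(3, 10) :=
  \matrix_(k, j) (eigenform 'X_[tnth cubic_monomials j] k).@[P 0].

Definition Phi_stack (F : fieldType) (n : nat) (P : n.-tuple 'rV[F]_3) :
    'M[F]_(\sum_(i < n) 3, 10) :=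
  \mxcol_(i < n) Phi (tnth P i).

(* The standard affine chart {x_i = 1}: x_i is replaced by 1 and the two other
   variables, in increasing order, become the variables of {mpoly F[2]}. *)
Definition dehomog (F : fieldType) (i : 'I_3) (g : {mpoly F[3]}) : {mpoly F[2]} :=
  g \mPo [tuple if unlift i j is Some k then 'X_k else 1 | j < 3].

(* The eigenscheme E(f) is covered by the three affine schemes
   Spec (F[u, v] / chart_ideal f i). *)
Definition chart_ideal (F : fieldType) (f : {mpoly F[3]}) (i : 'I_3)
    (h : {mpoly F[2]}) : Prop :=
  exists q : 'I_3 -> {mpoly F[2]},
    h = \sum_(k < 3) q k * dehomog i (eigenform f k).

(* The points of Spec (F[u, v] / chart_ideal f i), as prime ideals of F[u, v]. *)
Definition chart_point (F : fieldType) (f : {mpoly F[3]}) (i : 'I_3)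
    (p : {pred {mpoly F[2]}}) : Prop :=
  [/\ idealr_closed p, prime_idealr_closed p
    & forall h, chart_ideal f i h -> h \in p].

(* Every chart ring F[u, v] / chart_ideal f i is reduced. *)
Definition eigenscheme_reduced (F : fieldType) (f : {mpoly F[3]}) : Prop :=
  forall (i : 'I_3) (h : {mpoly F[2]}) (n : nat),
    chart_ideal f i (h ^+ n) -> chart_ideal f i h.

(* Krull dimension 0: E(f) is nonempty and there is no strict inclusion between
   prime ideals of a chart ring. *)
Definition eigenscheme_dim0 (F : fieldType) (f : {mpoly F[3]}) : Prop :=
  (exists i p, chart_point f i p) /\
  (forall i p q, chart_point f i p -> chart_point f i q ->
     {subset p <= q} -> {subset q <= p}).

Definition regular_eigenscheme (F : fieldType) (f : {mpoly F[3]}) : Prop :=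
  eigenscheme_reduced f /\ eigenscheme_dim0 f.

Lemma mem_cubic_monomials (m : 'X_{1..3}) :
  mdeg m = 3%N -> m \in cubic_monomials.
Proof.
rewrite mdegE !big_ord_recl big_ord0 addn0.
set a := m _; set b := m _; set c := m _ => abc.
have -> : m = [multinom [tuple a; b; c]].
  apply/mnmP => i; rewrite multinomE (tnth_nth 0%N).
  by case: i => [[|[|[|//]]] hi] /=; congr (m _); apply/val_inj.
move: a b c abc => {m}.
case=> [|[|[|[|a]]]]; case=> [|[|[|[|b]]]]; case=> [|[|[|[|c]]]] //=;
  by move/eqP; rewrite ?addnS ?addSn.
Qed.

Lemma cubicE (F : fieldType) (f : {mpoly F[3]}) : f \is 3.-homog ->
  f = \sum_(j < 10) f@_(tnth cubic_monomials j) *: 'X_[tnth cubic_monomials j].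
Proof.
move=> fh; apply/mpolyP => m; rewrite raddf_sum /=.
under eq_bigr do rewrite mcoeffZ mcoeffX.
have [/eqP/mem_cubic_monomials/tnthP[j mj]|m3] := boolP (mdeg m == 3%N).
  rewrite (bigD1 j) //= -mj eqxx mulr1 big1 ?addr0 // => k kj.
  have [kE|_] := eqVneq (tnth cubic_monomials k) m; last by rewrite mulr0.
  have/tuple_uniqP inj : uniq cubic_monomials by [].
  by move: kj; rewrite (inj k j) ?eqxx // kE.
rewrite (dhomog_nemf_coeff fh m3) big1 // => j _.
have [jE|_] := eqVneq (tnth cubic_monomials j) m; last by rewrite mulr0.
by rewrite jE (dhomog_nemf_coeff fh m3) mul0r.
Qed.

Lemma eigenform_sum (F : fieldType) (n : nat) (c : 'I_n -> F)
    (h : 'I_n -> {mpoly F[3]}) (k : 'I_3) :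
  eigenform (\sum_(j < n) c j *: h j) k = \sum_(j < n) c j *: eigenform (h j) k.
Proof.
case: k => [[|[|[|//]]] hk]; rewrite /eigenform (tnth_nth 0) /=;
  rewrite !raddf_sum /= !mulr_sumr -sumrB; apply: eq_bigr => j _;
  by rewrite !mderivZ -!scalerAr -scalerBr (tnth_nth 0).
Qed.

Lemma PhiE (F : fieldType) (P : 'rV[F]_3) (f : {mpoly F[3]}) :
  f \is 3.-homog ->
  Phi P *m cubic_coefs f = \col_k (eigenform f k).@[P 0].
Proof.
move=> fh; apply/colP => k; rewrite !mxE {2}(cubicE fh) eigenform_sum.
rewrite raddf_sum /=; apply: eq_bigr => j _.
by rewrite !mxE mevalZ mulrC.
Qed.

(* Main.v *)
(* Let N be the polarised gradient of f, so that P is an eigenpoint iff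
   N(P, P) is a multiple of P, and let p = P1.  As p, P2 and P3 are aligned
   eigenpoints, N(p, P2) = m p + n P2; similarly N(p, P4) = m' p + n' P4.
   If n = n', then N(p, _) induces a scalar on F^3 / p, so the member
   det (p, X, N(X, X)) of the net of the g_k has a triple point at p: it is the
   product of the lines P1P2, P1P4 and a third line through p, on which the two
   other eigenpoints have to lie.  Symmetry of N, delta2 = 0 and the
   nondegeneracy of the bilinear form force n = n', except when N(p, p) = 0 and
   the lines P1P2 and P1P4 are orthogonal.  In that case f composed with the
   orthogonal projection onto the span of p and P2 still has P1, ..., P5 as
   eigenpoints, hence is a multiple of f by the rank condition, and n = 0;
   likewise n' = 0.  All degenerate situations produce a line or a conic of
   eigenpoints, against dimension 0: the polynomials vanishing on the curve form
   a prime ideal that is not maximal. *)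

Require Import Defs.
From mathcomp Require Import all_boot all_order all_algebra.
From mathcomp Require Import reals complex mpoly.
From mathcomp Require Import ring.

Set Implicit Arguments.
Unset Strict Implicit.
Unset Printing Implicit Defensive.

Import GRing.Theory.
Local Open Scope ring_scope.
Local Open Scope complex_scope.

(** * Euler's relation for homogeneous polynomials *)

Lemma mulX_mderivX (n : nat) (F : fieldType) (m : 'X_{1..n}) (i : 'I_n) :
  'X_i * ('X_[m] : {mpoly F[n]})^`M(i) = 'X_[m] *+ m i.
Proof.
rewrite mderivX -scalerAr -mpolyXD scaler_nat.
case E: (m i) => [|k]; first by rewrite !mulr0n.
by rewrite addmC submK // lep1mP E.
Qed.

Lemma euler_mpoly (n : nat) (F : fieldType) (d : nat) (p : {mpoly F[n]}) :
  p \is d.-homog -> \sum_(i < n) 'X_i * p^`M(i) = p *+ d.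
Proof.
move=> /dhomogP ph; rewrite {1}(mpolyE p) [in RHS](mpolyE p).
under eq_bigr do rewrite raddf_sum mulr_sumr.
rewrite exchange_big -sumrMnl; apply: eq_big_seq => m /ph mE /=.
under eq_bigr do rewrite mderivZ -scalerAr mulX_mderivX.
by rewrite -scaler_sumr sumrMnr -mdegE mE scalerMnr.
Qed.

Lemma dhomog_mderiv (n : nat) (F : fieldType) (d : nat) (i : 'I_n)
    (p : {mpoly F[n]}) :
  p \is d.+1.-homog -> p^`M(i) \is d.-homog.
Proof.
move=> /dhomogP ph; apply/dhomogP => m; rewrite mcoeff_msupp mcoeff_mderiv => nz.
have : (m + U_(i))%MM \in msupp p.
  by rewrite mcoeff_msupp; apply: contraNneq nz => ->; rewrite mul0rn.
by move/ph; rewrite /= mdegD mdeg1 addn1 => -[].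
Qed.

Lemma meval_dhomog0 (n : nat) (F : fieldType) (p : {mpoly F[n]}) x y :
  p \is 0.-homog -> p.@[x] = p.@[y].
Proof.
move=> /dhomogP ph; rewrite !mevalE; apply: eq_big_seq => m /ph /= m0.
congr (_ * _); apply: eq_bigr => i _.
have -> : m i = 0%N; last by rewrite !expr0.
by move/eqP: m0; rewrite mdeg_eq0 => /eqP ->; rewrite mnm0E.
Qed.

(** * Polarisation of the gradient of a cubic *)

Definition grad (F : fieldType) (f : {mpoly F[3]}) (x : 'rV[F]_3) : 'rV[F]_3 :=
  \row_k (f^`M(k)).@[x 0].

Definition tens (F : fieldType) (T : 'I_3 -> 'I_3 -> 'I_3 -> F)
    (x y : 'rV[F]_3) : 'rV[F]_3 :=
  \row_k \sum_i \sum_j T i j k * (x 0 i * y 0 j).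

(** [T] is half the tensor of third derivatives: Euler's relation, applied to the quadratic partial
    derivatives of [f] and then to their linear ones, produces twice the gradient. *)
Lemma grad_tens (F : numFieldType) (f : {mpoly F[3]}) : f \is 3.-homog ->
  exists T : 'I_3 -> 'I_3 -> 'I_3 -> F,
    [/\ forall i j k, T i j k = T j i k, forall i j k, T i j k = T i k j
      & forall x, grad f x = tens T x x].
Proof.
move=> fh; pose T i j k := (f^`M(k)^`M(i)^`M(j)).@[fun=> 0] / 2.
exists T; split => [i j k|i j k|x].
- by rewrite /T (mderiv_comm i j).
- by rewrite /T (mderiv_comm k i) (mderiv_comm j i) (mderiv_comm j k).
apply/rowP => k; rewrite !mxE.
have h2 : f^`M(k) \is 2.-homog by exact: dhomog_mderiv.
have h1 i : f^`M(k)^`M(i) \is 1.-homog by exact: dhomog_mderiv.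
have n2 : (2 : F) != 0 by rewrite Num.Theory.pnatr_eq0.
apply: (mulfI n2); rewrite [LHS]mulrC mulr_natr -mevalMn -(euler_mpoly h2) raddf_sum mulr_sumr.
apply: eq_bigr => i _ /=.
rewrite mevalM mevalXU -[f^`M(k)^`M(i)]mulr1n -(euler_mpoly (h1 i)) raddf_sum !mulr_sumr.
apply: eq_bigr => j _ /=.
(* Third derivatives of a cubic have degree 0, so the evaluation point 0 chosen in [T] may replace
   [x]. *)
rewrite mevalM mevalXU (@meval_dhomog0 _ _ _ _ (fun=> 0)) ?dhomog_mderiv // /T.
by field.
Qed.

(** The cubic is a third of $T(x,x,x)$: differentiation hits each of the three slots, and by
    symmetry the three contributions agree. This turns a projected tensor back into a cubic, to
    which the rank condition applies. *)
Lemma tens_grad (F : numFieldType) (T : 'I_3 -> 'I_3 -> 'I_3 -> F) :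
  (forall i j k, T i j k = T j i k) -> (forall i j k, T i j k = T i k j) ->
  exists2 f : {mpoly F[3]}, f \is 3.-homog & forall x, grad f x = tens T x x.
Proof.
move=> T12 T23.
exists (3^-1 *: \sum_i \sum_j \sum_k T i j k *: ('X_i * 'X_j * 'X_k)).
  apply/dhomogZ/rpred_sum => i _; apply/rpred_sum => j _; apply/rpred_sum => k _.
  apply: dhomogZ; rewrite -!mpolyXD dhomogX /= !mdegD !mdeg1 //.
move=> x; apply/rowP => l; rewrite !mxE mderivZ mevalZ.
have n3 : (3 : F) != 0 by rewrite Num.Theory.pnatr_eq0.
apply: (mulfI n3); rewrite mulVKf //.
rewrite (raddf_sum (mderiv l)) raddf_sum /=.
pose D (i j : 'I_3) : F := (i == j)%:R.
have DE i j : ('X_i : {mpoly F[3]})^`M(j) = (D i j)%:MP.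
  rewrite mderivX mnm1E /D; case: eqP => [->|_]; last by rewrite scale0r mpolyC0.
  by rewrite -[U_(j)%MM as X in (X - _)%MM]add0m addmK scale1r mpolyX0 mpolyC1.
have sumD (G : 'I_3 -> F) : \sum_i D i l * G i = G l.
  rewrite (bigD1 l) //= /D eqxx mul1r big1 ?addr0 // => i /negbTE ->.
  by rewrite mul0r.
transitivity (\sum_i \sum_j \sum_k (D i l * (T i j k * (x 0 j * x 0 k)) +
   D j l * (T i j k * (x 0 i * x 0 k)) + D k l * (T i j k * (x 0 i * x 0 j)))).
  apply: eq_bigr => i _; rewrite (raddf_sum (mderiv l)) raddf_sum; apply: eq_bigr => j _ /=.
  rewrite (raddf_sum (mderiv l)) raddf_sum; apply: eq_bigr => k _ /=.
  rewrite mderivZ mevalZ !mderivM !DE mulrDl !(mevalD, mevalM, mevalC, mevalXU).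
  by ring.
transitivity (\sum_i D i l * (\sum_j \sum_k T i j k * (x 0 j * x 0 k)) +
    \sum_i \sum_j D j l * (\sum_k T i j k * (x 0 i * x 0 k)) +
    \sum_i \sum_j \sum_k D k l * (T i j k * (x 0 i * x 0 j))).
  rewrite -!big_split; apply: eq_bigr => i _ /=; rewrite mulr_sumr -!big_split.
  apply: eq_bigr => j _ /=; rewrite !mulr_sumr -!big_split.
  by apply: eq_bigr.
rewrite sumD; under [in X in _ + X + _]eq_bigr do rewrite sumD.
under [in X in _ + _ + X]eq_bigr do under eq_bigr do rewrite sumD.
rewrite mulr_natl !mulrS mulr0n addr0 addrA.
congr (_ + _ + _).
- by apply: eq_bigr => i _; apply: eq_bigr => j _; rewrite T12 (T23 i l).
- by apply: eq_bigr => i _; apply: eq_bigr => j _; rewrite T23.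
Qed.

(** * Rational curves of eigenpoints contradict dimension 0 *)

Lemma poly_neq0_horner (F : numFieldType) (p : {poly F}) :
  p != 0 -> exists w, p.[w] != 0.
Proof.
(* In characteristic 0 these are [size p] distinct scalars, one more than the degree. *)
move=> pn0; pose rs : seq F := [seq n%:R | n <- iota 0 (size p)].
have /allPn[w _ wn] : ~~ all (root p) rs by
  apply: contra pn0 => rsp; apply/eqP; apply: (roots_geq_poly_eq0 rsp);
  [rewrite map_inj_uniq ?iota_uniq //; apply: Num.Theory.mulrIn; rewrite oner_neq0
  |rewrite size_map size_iota].
by exists w.
Qed.

Lemma meval_dhomogZ (n : nat) (F : fieldType) (d : nat) (p : {mpoly F[n]})
    (c : F) (x : 'I_n -> F) :
  p \is d.-homog -> p.@[fun i => c * x i] = c ^+ d * p.@[x].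
Proof.
move=> /dhomogP ph; rewrite !mevalE mulr_sumr; apply: eq_big_seq => m /ph /= <-.
under eq_bigr do rewrite exprMn.
by rewrite big_split /= mdegE expr_sum mulrCA.
Qed.

Lemma dhomog_eigenform (F : fieldType) (f : {mpoly F[3]}) (k : 'I_3) :
  f \is 3.-homog -> eigenform f k \is 3.-homog.
Proof.
move=> fh; have h i j : 'X_i * f^`M(j) \is 3.-homog.
  by rewrite -[3%N]/(1 + 2)%N dhomogM ?dhomogX /= ?mdeg1 ?dhomog_mderiv.
by case: k => [[|[|[|//]]] hk]; rewrite /eigenform (tnth_nth 0) /= rpredB ?h.
Qed.

Definition affine_coords (F : fieldType) (i : 'I_3) (x : 'I_3 -> F) (k : 'I_2) : F :=
  x (lift i k) / x i.

Lemma meval_dehomog (F : fieldType) (d : nat) (i : 'I_3) (x : 'I_3 -> F)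
    (g : {mpoly F[3]}) :
  g \is d.-homog -> x i != 0 ->
  (dehomog i g).@[affine_coords i x] = (x i)^-1 ^+ d * g.@[x].
Proof.
move=> gh xi; rewrite /dehomog comp_mpoly_meval -meval_dhomogZ //.
apply: meval_eq => j.
rewrite tnth_mktuple; case: unliftP => [k|] ->.
  by rewrite mevalXU mulrC.
by rewrite meval1 mulVf.
Qed.

(** Clearing denominators makes the restriction of [h] to the curve a polynomial in the parameter;
    the primality of the ideal of the curve is then inherited from the domain [{poly F}]. *)
Lemma affine_numerator (F : fieldType) (i : 'I_3) (X : 'I_3 -> {poly F})
    (h : {mpoly F[2]}) :
  exists (A : {poly F}) (n : nat), forall w, (X i).[w] != 0 ->
    A.[w] = (X i).[w] ^+ n * h.@[affine_coords i (fun j => (X j).[w])].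
Proof.
elim/mpolyind: h => [|c m h _ _ [A [n hA]]].
  by exists 0, 0%N => w _; rewrite horner0 meval0 mulr0.
pose B := \prod_(k < 2) X (lift i k) ^+ m k.
exists (c *: B * X i ^+ n + A * X i ^+ mdeg m), (n + mdeg m)%N => w wi.
rewrite hornerD !hornerM !horner_exp hornerZ hA // mevalD mevalZ mevalX mulrDr.
congr (_ + _); last by rewrite exprD; ring.
rewrite exprD horner_prod.
under eq_bigr do rewrite horner_exp.
under [in RHS]eq_bigr do rewrite /affine_coords expr_div_n.
rewrite prodf_div mdegE prodrXr.
set u := X i; set a := \prod_(_ < _) _; set e := \sum_(_ < _) _.
have un : u.[w] ^+ e != 0 by rewrite expf_neq0.
by field.
Qed.

(** If two values of [X] were not proportional, the ideal [p] of the curve in some chart would be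
    strictly contained in the ideal [q] of one of its points. *)
Lemma eigencurve_constant (F : numFieldType) (f : {mpoly F[3]})
    (X : 'I_3 -> {poly F}) :
  f \is 3.-homog -> eigenscheme_dim0 f ->
  (forall w k, (eigenform f k).@[fun j => (X j).[w]] = 0) ->
  forall w0 w1 i j, (X i).[w0] * (X j).[w1] = (X j).[w0] * (X i).[w1].
Proof.
move=> fh [_ dim0] EX w0 w1.
suff main i j : (X i).[w0] != 0 -> (X i).[w0] * (X j).[w1] = (X j).[w0] * (X i).[w1].
  move=> i j; have [i0|] := eqVneq (X i).[w0] 0; last exact: main.
  have [j0|/main->] := eqVneq (X j).[w0] 0; last by [].
  by rewrite i0 j0 !mul0r.
move=> i0; apply/eqP; rewrite -subr_eq0; apply/negPn/negP => M1.
(* [M] vanishes at [w0]. A parameter [w2] where neither [M] nor [X i] vanishes gives another point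
   of the same chart, with a different ratio of the coordinates [j] and [i]. *)
pose M := (X i).[w0] *: X j - (X j).[w0] *: X i.
have ij : i != j by apply: contraNneq M1 => ->; rewrite subrr.
have /poly_neq0_horner[w2] : M * X i != 0.
  rewrite mulf_neq0 //; last by apply: contraNneq i0 => ->; rewrite horner0.
  by apply: contraNneq M1 => M0; rewrite -!hornerZ -hornerN -hornerD -/M M0 horner0.
rewrite hornerM mulf_eq0 negb_or => /andP[M2 i2].
pose x w j := (X j).[w].
pose p : {pred {mpoly F[2]}} := fun h =>
  boolp.asbool (forall w, x w i != 0 -> h.@[affine_coords i (x w)] = 0).
pose q : {pred {mpoly F[2]}} := fun h => h.@[affine_coords i (x w0)] == 0.
have chart0 h w : x w i != 0 -> chart_ideal f i h -> h.@[affine_coords i (x w)] = 0.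
  move=> wi [a ->]; rewrite raddf_sum big1 // => k _.
  by rewrite /= mevalM (@meval_dehomog _ 3) ?dhomog_eigenform // EX !mulr0.
have pP : chart_point f i p.
  split.
  - split=> [|| a u v /boolp.asboolP hu /boolp.asboolP hv].
    + by apply/boolp.asboolP => w _; rewrite meval0.
    + by apply/negP => /boolp.asboolP/(_ _ i0)/eqP; rewrite meval1 oner_eq0.
    + by apply/boolp.asboolP => w wi; rewrite mevalD mevalM hu // hv // mulr0 addr0.
  - move=> u v /boolp.asboolP uv.
    have [A [n hA]] := affine_numerator i X u.
    have [B [m hB]] := affine_numerator i X v.
    (* The factor [X i] compensates for [A] and [B] being controlled only where [X i] is nonzero. *)
    have : A * B * X i == 0.
      apply/negPn/negP => /poly_neq0_horner[w]; rewrite !hornerM mulf_eq0 negb_or.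
      move=> /andP[AB wi]; move/eqP: AB; apply; rewrite hA // hB //.
      by rewrite mulrACA -mevalM uv // mulr0.
    have Xi : X i != 0 by apply: contraNneq i0 => ->; rewrite horner0.
    rewrite !mulf_eq0 (negbTE Xi) orbF => /orP[] /eqP Z0; apply/orP; [left|right];
      apply/boolp.asboolP => w wi; [move: (hA w wi)|move: (hB w wi)];
      rewrite Z0 horner0 => /esym/eqP; rewrite mulf_eq0 expf_eq0 (negbTE wi) andbF;
      by move/eqP.
  - by move=> h hI; apply/boolp.asboolP => w wi; apply: chart0.
have qE h : (h \in q) = (h.@[affine_coords i (x w0)] == 0) by [].
have qP : chart_point f i q.
  split.
  - split=> [|| a u v /eqP hu /eqP hv].
    + by apply/eqP; rewrite meval0.
    + by rewrite qE meval1 oner_eq0.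
    + by apply/eqP; rewrite mevalD mevalM hu hv mulr0 addr0.
  - by move=> u v; rewrite !qE mevalM mulf_eq0.
  - by move=> h hI; apply/eqP; apply: chart0.
have pq : {subset p <= q} by move=> h /boolp.asboolP hp; apply/eqP; apply: hp.
have [k jk|] := unliftP i j; last by move/eqP; rewrite eq_sym (negbTE ij).
(* Dimension 0 forces this element of [q] into [p], although it does not vanish at [w2]. *)
have /(dim0 i p q pP qP pq)/boolp.asboolP/(_ w2 i2)/eqP :
    'X_k - (affine_coords i (x w0) k)%:MP \in q.
  by apply/eqP; rewrite mevalB mevalXU mevalC subrr.
rewrite mevalB mevalXU mevalC subr_eq0 /affine_coords -jk eqr_div //.
move=> E; move/negP: M2; apply; rewrite /M hornerD hornerN !hornerZ subr_eq0.
by rewrite mulrC (eqP E).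
Qed.

(** * Scalar relations between the pairings of the five points *)

(** Certificates for elimination: [eqD] and [eqM] combine the hypotheses into [u = v], and [ring]
    checks the remaining identity. *)
Lemma lincomb (R : zmodType) (x y u v : R) : u = v -> x - y = u - v -> x = y.
Proof. by move=> ->; rewrite subrr => /eqP; rewrite subr_eq0 => /eqP. Qed.

Lemma eqD (R : zmodType) (x y u v : R) : x = y -> u = v -> x + u = y + v.
Proof. by move=> -> ->. Qed.

Lemma eqM (R : pzRingType) (c x y : R) : x = y -> c * x = c * y.
Proof. by move=> ->. Qed.

(** The determinant of the Gram matrix of P1, P2, P4. *)
Definition gram (F : fieldType) (s11 s12 s22 s14 s24 s44 : F) : F :=
  s11 * (s22 * s44 - s24 ^+ 2) - s12 * (s12 * s44 - s24 * s14)
  + s14 * (s12 * s24 - s22 * s14).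

(* Here s_ij stands for bil P_i P_j and P3 = a P1 + b P2, P5 = c P1 + d P4. *)
Lemma gram_neq0_line (F : fieldType) (s11 s12 s22 s14 s24 s44 a b : F) :
  b != 0 -> gram s11 s12 s22 s14 s24 s44 != 0 -> s11 * s24 = s12 * s14 ->
  a * s12 + b * s22 = 0 -> s12 * (a * s11 + b * s12) != 0.
Proof.
move=> b0 G0 d1 s23; apply: contraNneq G0 => /eqP; rewrite mulf_eq0.
case/orP=> /eqP s0.
  move: s23 d1; rewrite s0 mulr0 add0r => /eqP; rewrite mulf_eq0 (negbTE b0) /=.
  rewrite mul0r => /eqP s22z s24z; rewrite /gram s22z; apply/eqP.
  by apply: (lincomb (eqM (- s24) s24z)); ring.
have /eqP : b * gram s11 s12 s22 s14 s24 s44 = 0.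
  apply: (lincomb (eqD (eqD (eqM (s14 * s24 - s12 * s44) s0)
    (eqM (s11 * s44 - s14 ^+ 2) s23)) (eqM (- (a * s14 + b * s24)) d1))).
  by rewrite /gram; ring.
by rewrite mulf_eq0 (negbTE b0).
Qed.

(** The relations express the symmetry of N on the two lines, and [D] is [delta2] = 0. Eliminating
    [m] and [m'] leaves equations in which [n - n'] can be cancelled; the Gram determinant excludes
    the degenerate solutions. *)
Lemma nu_dichotomy (F : fieldType)
    (s11 s12 s22 s14 s24 s44 a b c d m n m' n' l : F) :
  b != 0 -> d != 0 -> gram s11 s12 s22 s14 s24 s44 != 0 ->
  l * s12 = m * s11 + n * s12 -> l * s14 = m' * s11 + n' * s14 ->
  m * (a * s11 + b * s12) = n * (a * s12 + b * s22) ->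
  m' * (c * s11 + d * s14) = n' * (c * s14 + d * s44) ->
  m * s14 + n * s24 = m' * s12 + n' * s24 ->
  s12 * (a * s11 + b * s12) * (c * s14 + d * s44) =
    s14 * (c * s11 + d * s14) * (a * s12 + b * s22) ->
  n != n' -> [/\ s11 != 0, l = 0 & s11 * s24 = s12 * s14].
Proof.
move=> b0 d0 G0 e1 e1' e2 e2' es D nn.
have nn0 : n - n' != 0 by rewrite subr_eq0.
have d1 : s11 * s24 = s12 * s14.
  apply: (mulfI nn0).
  by apply: (lincomb (eqD (eqD (eqM s14 e1) (eqM (- s12) e1')) (eqM s11 es))); ring.
have G0' : gram s11 s14 s44 s12 s24 s22 != 0.
  by apply: contraNneq G0 => <-; rewrite /gram; apply/eqP; ring.
have d1' : s11 * s24 = s14 * s12 by rewrite d1 mulrC.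
have A := gram_neq0_line (a := a) b0 G0 d1.
have A' := gram_neq0_line (a := c) d0 G0' d1'.
set s13 := a * s11 + b * s12 in e2 D A *.
set s23 := a * s12 + b * s22 in e2 D A *.
set s15 := c * s11 + d * s14 in e2' D A' *.
set s45 := c * s14 + d * s44 in e2' D A' *.
have f1 : n * (s11 * s23 + s12 * s13) = l * (s12 * s13).
  by apply: (lincomb (eqD (eqM (- s13) e1) (eqM (- s11) e2))); ring.
have f2 : n' * (s11 * s45 + s14 * s15) = l * (s14 * s15).
  by apply: (lincomb (eqD (eqM (- s15) e1') (eqM (- s11) e2'))); ring.
(* By [D] the coefficients in [f1] and [f2] are proportional, so suitable combinations are multiples
   of [n - n']. By [A'], one of [s45] and [s14 * s15] is nonzero. *)
have z1 : s11 * s23 + s12 * s13 = 0.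
  have h1 : s14 * s15 * (s11 * s23 + s12 * s13) = 0.
    apply: (mulfI nn0).
    by apply: (lincomb (eqD (eqD (eqM (s14 * s15) f1) (eqM (- (s12 * s13)) f2))
      (eqM (n' * s11) D))); ring.
  have h2 : s45 * (s11 * s23 + s12 * s13) = 0.
    apply: (mulfI nn0).
    by apply: (lincomb (eqD (eqD (eqM s45 f1) (eqM (- s23) f2))
      (eqM (l - n') D))); ring.
  have [s450|s450] := eqVneq s45 0.
    by move/eqP: h1; rewrite mulf_eq0 (negbTE (A' s450)) => /eqP.
  by move/eqP: h2; rewrite mulf_eq0 (negbTE s450) => /eqP.
have z2 : s11 * s45 + s14 * s15 = 0.
  have [s230|s230] := eqVneq s23 0.
    by move: z1 (A s230); rewrite s230 mulr0 add0r => ->; rewrite eqxx.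
  apply: (mulfI s230).
  by apply: (lincomb (eqD (eqM s45 z1) (eqM (-1) D))); ring.
(* If [s11] were 0, then [z1] and [z2] would make P1 orthogonal to P1, P2 and P4. *)
have s110 : s11 != 0.
  apply: contraNneq G0 => s110; move: z1 z2.
  rewrite /s13 /s15 s110 !mul0r !mulr0 !add0r => /eqP.
  rewrite !mulf_eq0 (negbTE b0) /= orbb => /eqP s12z /eqP.
  rewrite !mulf_eq0 (negbTE d0) /= orbb => /eqP s14z.
  by rewrite /gram s12z s14z; apply/eqP; ring.
split=> //.
move: f1; rewrite z1 mulr0 => /esym/eqP; rewrite mulf_eq0 => /orP[/eqP //|s130].
have [s230|s230] := eqVneq s23 0.
  by move: (A s230); rewrite s130.
move: z1; rewrite (eqP s130) addr0 => /eqP.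
by rewrite mulf_eq0 (negbTE s110) (negbTE s230).
Qed.

(** * Linearity and symmetry of [tens] and [bil] *)

Lemma tensC (F : fieldType) (T : 'I_3 -> 'I_3 -> 'I_3 -> F) x y :
  (forall i j k, T i j k = T j i k) -> tens T x y = tens T y x.
Proof.
move=> T12; apply/rowP => k; rewrite !mxE exchange_big /=.
apply: eq_bigr => i _; apply: eq_bigr => j _.
by rewrite T12 (mulrC (x 0 j)).
Qed.

Lemma tensDl (F : fieldType) (T : 'I_3 -> 'I_3 -> 'I_3 -> F) x y z :
  tens T (x + y) z = tens T x z + tens T y z.
Proof.
apply/rowP => k; rewrite !mxE -big_split; apply: eq_bigr => i _ /=.
rewrite -big_split; apply: eq_bigr => j _ /=; rewrite !mxE; ring.
Qed.

Lemma tensZl (F : fieldType) (T : 'I_3 -> 'I_3 -> 'I_3 -> F) c x z :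
  tens T (c *: x) z = c *: tens T x z.
Proof.
apply/rowP => k; rewrite !mxE mulr_sumr; apply: eq_bigr => i _ /=.
rewrite mulr_sumr; apply: eq_bigr => j _ /=; rewrite !mxE; ring.
Qed.

Lemma bilC (F : fieldType) (x y : 'rV[F]_3) : bil x y = bil y x.
Proof. by apply: eq_bigr => i _; rewrite mulrC. Qed.

Lemma bilDl (F : fieldType) (x y z : 'rV[F]_3) : bil (x + y) z = bil x z + bil y z.
Proof. by rewrite /bil -big_split; apply: eq_bigr => i _; rewrite mxE mulrDl. Qed.

Lemma bilZl (F : fieldType) c (x z : 'rV[F]_3) : bil (c *: x) z = c * bil x z.
Proof. by rewrite /bil mulr_sumr; apply: eq_bigr => i _; rewrite mxE mulrA. Qed.

Lemma bilDr (F : fieldType) (x y z : 'rV[F]_3) : bil z (x + y) = bil z x + bil z y.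
Proof. by rewrite bilC bilDl !(bilC z). Qed.

Lemma bilZr (F : fieldType) c (x z : 'rV[F]_3) : bil z (c *: x) = c * bil z x.
Proof. by rewrite bilC bilZl (bilC z). Qed.

Lemma bil_tens (F : fieldType) (T : 'I_3 -> 'I_3 -> 'I_3 -> F) x y z :
  (forall i j k, T i j k = T i k j) -> bil (tens T x y) z = bil (tens T x z) y.
Proof.
move=> T23; rewrite /bil.
under eq_bigr do rewrite mxE mulr_suml.
under [in RHS]eq_bigr do rewrite mxE mulr_suml.
rewrite exchange_big [in RHS]exchange_big /=; apply: eq_bigr => i _.
under eq_bigr do rewrite mulr_suml.
under [in RHS]eq_bigr do rewrite mulr_suml.
rewrite exchange_big /=; apply: eq_bigr => j _; apply: eq_bigr => k _.
by rewrite T23; ring.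
Qed.

Lemma bil_eq0 (F : fieldType) (x : 'rV[F]_3) : (forall z, bil x z = 0) -> x = 0.
Proof.
move=> x0; apply/rowP => k; rewrite mxE -(x0 (delta_mx 0 k)) /bil (bigD1 k) //=.
rewrite mxE !eqxx mulr1 big1 ?addr0 // => j /negbTE jk.
by rewrite mxE jk andbF mulr0.
Qed.

(** * Coordinates on three non-aligned points *)

Definition rows3 (F : fieldType) (p q t : 'rV[F]_3) : 'M[F]_3 :=
  \matrix_i tnth [tuple p; q; t] i.

Lemma rows3_sum (F : fieldType) (p q t : 'rV[F]_3) (u : 'rV[F]_3) :
  u *m rows3 p q t = u 0 ix *: p + u 0 iy *: q + u 0 iz *: t.
Proof.
rewrite mulmx_sum_row !big_ord_recl big_ord0 addr0 !rowK !(tnth_nth 0) addrA.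
by congr (u 0 _ *: p + u 0 _ *: q + u 0 _ *: t); apply/val_inj.
Qed.

Lemma aligned_det (F : fieldType) (p q t : 'rV[F]_3) :
  \det (rows3 p q t) = 0 -> aligned p q t.
Proof.
move/eqP; rewrite -det_tr => /det0P[v v0 vA]; exists v^T.
have A0 : rows3 p q t *m v^T = 0 by rewrite -[rows3 _ _ _]trmxK -trmx_mul vA trmx0.
have R i : tnth [tuple p; q; t] i *m v^T = 0.
  by rewrite -[tnth _ i](rowK (tnth [tuple p; q; t])) -row_mul A0 row0.
split; [|exact: (R ix)|exact: (R iy)|exact: (R iz)].
by apply: contraNneq v0 => /(congr1 trmx); rewrite trmxK trmx0 => ->.
Qed.

Lemma aligned_dep (F : fieldType) (p q t : 'rV[F]_3) (a b c : F) :
  c != 0 -> a *: p + b *: q + c *: t = 0 -> aligned p q t.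
Proof.
move=> c0 dep; apply: aligned_det; apply/eqP/det0P.
exists (\row_j tnth [tuple a; b; c] j).
  by apply: contraNneq c0 => /rowP/(_ iz); rewrite !mxE (tnth_nth 0) /= => ->.
by rewrite rows3_sum !mxE !(tnth_nth 0).
Qed.

Lemma rows3_unit (F : fieldType) (p q t : 'rV[F]_3) :
  ~ aligned p q t -> rows3 p q t \in unitmx.
Proof.
by move=> npqt; rewrite unitmxE unitfE; apply/eqP => /aligned_det.
Qed.

Lemma nonaligned_span (F : fieldType) (p q t x : 'rV[F]_3) :
  ~ aligned p q t -> exists r s u, x = r *: p + s *: q + u *: t.
Proof.
move=> /rows3_unit Mu; rewrite -[x](mulmxKV Mu) rows3_sum.
by do 3![eexists].
Qed.

Lemma nonaligned_free (F : fieldType) (p q t : 'rV[F]_3) (r s u r' s' u' : F) :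
  ~ aligned p q t ->
  r *: p + s *: q + u *: t = r' *: p + s' *: q + u' *: t ->
  [/\ r = r', s = s' & u = u'].
Proof.
move=> /rows3_unit Mu E.
have /(can_inj (mulmxK Mu))/rowP M : (\row_j tnth [tuple r; s; u] j) *m rows3 p q t =
    (\row_j tnth [tuple r'; s'; u'] j) *m rows3 p q t.
  by rewrite !rows3_sum !mxE !(tnth_nth 0).
by split; [move: (M ix)|move: (M iy)|move: (M iz)]; rewrite !mxE !(tnth_nth 0).
Qed.

Lemma det3E (F : fieldType) (A : 'M[F]_3) : \det A =
  A ix ix * (A iy iy * A iz iz - A iy iz * A iz iy)
  - A ix iy * (A iy ix * A iz iz - A iy iz * A iz ix)
  + A ix iz * (A iy ix * A iz iy - A iy iy * A iz ix).
Proof.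
(* Indexing by natural numbers lets the ordinals from the nested expansions be compared by
   computation. *)
pose g (m n : nat) := A (inord m) (inord n).
have AE i j : A i j = g i j by rewrite /g !inord_val.
rewrite (expand_det_row _ ord0) !big_ord_recl big_ord0 /cofactor.
rewrite !(expand_det_row _ ord0) !big_ord_recl !big_ord0 /cofactor !det_mx11 !mxE.
by rewrite !AE /= /bump /=; ring.
Qed.

(** The Gram matrix is M times the transpose of M, so its determinant is the square of det M. *)
Lemma gram_neq0 (F : fieldType) (p q t : 'rV[F]_3) : ~ aligned p q t ->
  gram (bil p p) (bil p q) (bil q q) (bil p t) (bil q t) (bil t t) != 0.
Proof.
move=> /rows3_unit; rewrite unitmxE unitfE => d0.
suff -> : gram (bil p p) (bil p q) (bil q q) (bil p t) (bil q t) (bil t t) =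
    \det (rows3 p q t) * \det (rows3 p q t) by rewrite mulf_neq0.
rewrite -[X in _ * X]det_tr -det_mulmx det3E.
have E i j : (rows3 p q t *m (rows3 p q t)^T) i j =
    bil (tnth [tuple p; q; t] i) (tnth [tuple p; q; t] j).
  by rewrite !mxE; apply: eq_bigr => k _; rewrite !mxE.
rewrite !E !(tnth_nth 0) /= (bilC q p) (bilC t p) (bilC t q) /gram.
by ring.
Qed.

Lemma minors_eq0 (F : fieldType) (x y : 'rV[F]_3) :
  x != 0 -> (forall i j, x 0 i * y 0 j = x 0 j * y 0 i) -> exists c, y = c *: x.
Proof.
move=> /rV0Pn[i xi] xy; exists (y 0 i / x 0 i); apply/rowP => j.
by rewrite mxE mulrAC -[y 0 i * _]mulrC -xy mulrAC divff // mul1r.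
Qed.

(** The standard basis is orthonormal for [bil], so the entries of T are values of the trilinear
    form on basis vectors and inherit its symmetry. *)
Lemma bilinear_tens (F : fieldType) (B : 'rV[F]_3 -> 'rV[F]_3 -> 'rV[F]_3) :
  (forall x y z, B (x + y) z = B x z + B y z) ->
  (forall c x z, B (c *: x) z = c *: B x z) ->
  (forall x y, B x y = B y x) ->
  (forall x y z, bil (B x y) z = bil (B x z) y) ->
  exists T, [/\ forall i j k, T i j k = T j i k, forall i j k, T i j k = T i k j
    & forall x y, tens T x y = B x y].
Proof.
move=> BD BZ BC Bs; pose e i : 'rV[F]_3 := delta_mx 0 i.
have ek x k : bil x (e k) = x 0 k.
  rewrite /bil (bigD1 k) //= mxE !eqxx mulr1 big1 ?addr0 // => j /negbTE jk.
  by rewrite mxE jk andbF mulr0.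
exists (fun i j k => B (e i) (e j) 0 k); split => [i j k|i j k|x y].
- by rewrite BC.
- by rewrite -!ek Bs.
have B0 z : B 0 z = 0 by have := BZ 0 0 z; rewrite !scale0r.
have Bl x' z : B x' z = \sum_i x' 0 i *: B (e i) z.
  rewrite {1}[x']row_sum_delta (big_morph (B^~ z) (fun u v => BD u v z) (B0 z)).
  by apply: eq_bigr => i _; rewrite BZ.
apply/rowP => k; rewrite Bl summxE mxE; apply: eq_bigr => i _.
rewrite BC Bl !mxE summxE mulr_sumr; apply: eq_bigr => j _.
by rewrite !mxE BC; ring.
Qed.

(** Then [bil (N x y) z] is the polarisation of a ternary cubic, whose gradient at x is proportional
    to [N x x]. Stating this without coordinates covers both [tens T] and its projection. *)
Definition sym_trilinear (F : fieldType) (N : 'rV[F]_3 -> 'rV[F]_3 -> 'rV[F]_3) :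
    Prop :=
  [/\ forall x y z, N (x + y) z = N x z + N y z,
      forall c x z, N (c *: x) z = c *: N x z,
      forall x y, N x y = N y x
    & forall x y z, bil (N x y) z = bil (N x z) y].

(** The zero vector is allowed, so that a polynomial family may pass through it. *)
Definition eigenvec (F : fieldType) (N : 'rV[F]_3 -> 'rV[F]_3 -> 'rV[F]_3)
    (x : 'rV[F]_3) : Prop :=
  exists l, N x x = l *: x.

(** * Eigenvectors on a line *)

Section SymmetricTrilinear.
Variables (F : numFieldType) (N : 'rV[F]_3 -> 'rV[F]_3 -> 'rV[F]_3).
Hypothesis hN : sym_trilinear N.
Implicit Types p q t x y : 'rV[F]_3.

Let two0 : (2 : F) != 0. Proof. by rewrite Num.Theory.pnatr_eq0. Qed.

Lemma trilin2 (r s : F) p q :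
  N (r *: p + s *: q) (r *: p + s *: q) =
  r ^+ 2 *: N p p + (2 * r * s) *: N p q + s ^+ 2 *: N q q.
Proof.
have [ND NZ NC _] := hN.
rewrite !(ND, NZ) ![N _ (_ + _)]NC !(ND, NZ) (NC q p).
by apply/rowP => k; rewrite !mxE; ring.
Qed.

Lemma trilin3 (r s u : F) p q t :
  N (r *: p + s *: q + u *: t) (r *: p + s *: q + u *: t) =
  r ^+ 2 *: N p p + s ^+ 2 *: N q q + u ^+ 2 *: N t t
  + (2 * r * s) *: N p q + (2 * r * u) *: N p t + (2 * s * u) *: N q t.
Proof.
have [ND NZ NC _] := hN.
rewrite !(ND, NZ) ![N _ (_ + _)]NC !(ND, NZ) (NC q p) (NC t p) (NC t q).
by apply/rowP => k; rewrite !mxE; ring.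
Qed.

(** Expanding N at the third eigenvector isolates the cross term [2 * a * b] times [N p q]; the two
    equations compare the coefficients of p and q. *)
Lemma eigen_line p q (a b l1 l2 l3 : F) : a != 0 -> b != 0 ->
  N p p = l1 *: p -> N q q = l2 *: q ->
  N (a *: p + b *: q) (a *: p + b *: q) = l3 *: (a *: p + b *: q) ->
  exists m n, [/\ N p q = m *: p + n *: q,
    2 * b * m + a * l1 = l3 & 2 * a * n + b * l2 = l3].
Proof.
move=> a0 b0 e1 e2 e3.
exists ((l3 - a * l1) / (2 * b)), ((l3 - b * l2) / (2 * a)).
split; last 2 first; try by field; rewrite ?a0 ?b0 ?two0.
move: e3; rewrite trilin2 e1 e2 => /rowP e3; apply/rowP => k.
have := e3 k; rewrite !mxE => e3k.
apply: (lincomb (eqM (2 * a * b)^-1 e3k)); field.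
by rewrite a0 b0.
Qed.

(** Symmetry gives N(p,p).q = N(p,q).p and N(q,q).p = N(p,q).q; the second relation results from
    eliminating [l3]. *)
Lemma eigen_line_rel p q (a b l1 l2 l3 m n : F) :
  N p p = l1 *: p -> N q q = l2 *: q -> N p q = m *: p + n *: q ->
  2 * b * m + a * l1 = l3 -> 2 * a * n + b * l2 = l3 ->
  l1 * bil p q = m * bil p p + n * bil p q /\
  m * (a * bil p p + b * bil p q) = n * (a * bil p q + b * bil q q).
Proof.
have [_ _ NC Ns] := hN => e1 e2 e12 e3 e3'.
have := Ns p p q; rewrite e1 e12 !(bilZl, bilDl) (bilC q p) => r1; split=> //.
have := Ns q q p; rewrite e2 (NC q p) e12 !(bilZl, bilDl) (bilC q p) => r2.
apply: (lincomb (eqD (eqD (eqM (bil p q) (etrans e3 (esym e3')))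
  (eqM (- a) r1)) (eqM b r2))); ring.
Qed.

(** The third and fourth points give two independent linear equations in [l1 - 2 * n] and
    [l2 - 2 * m]. Both quantities vanish, and N(x, x) is then a multiple of x on the whole line. *)
Lemma four_eigen_line p q t (a b l1 l2 l3 r s : F) : ~ aligned p q t ->
  a != 0 -> b != 0 -> r != 0 -> s != 0 -> r * b != s * a ->
  N p p = l1 *: p -> N q q = l2 *: q ->
  N (a *: p + b *: q) (a *: p + b *: q) = l3 *: (a *: p + b *: q) ->
  eigenvec N (r *: p + s *: q) ->
  forall g h, eigenvec N (g *: p + h *: q).
Proof.
move=> npqt a0 b0 r0 s0 rs e1 e2 e3 [l el] g h.
have [m [n [e12 f1 f2]]] := eigen_line a0 b0 e1 e2 e3.
have [m' [n' [e12' f1' f2']]] := eigen_line r0 s0 e1 e2 el.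
have [|mm nn _] := @nonaligned_free F p q t m n 0 m' n' 0 npqt.
  by rewrite -e12 -e12'.
rewrite -{}mm -{}nn in f1' f2'.
have g1 : a * (l1 - 2 * n) = b * (l2 - 2 * m).
  by apply: (lincomb (etrans f1 (esym f2))); ring.
have g2 : r * (l1 - 2 * n) = s * (l2 - 2 * m).
  by apply: (lincomb (etrans f1' (esym f2'))); ring.
have h1 : l1 = 2 * n.
  apply/eqP; rewrite -subr_eq0; apply/eqP.
  have rsn : r * b - s * a != 0 by rewrite subr_eq0.
  apply: (mulfI rsn).
  by apply: (lincomb (eqD (eqM b g2) (eqM (- s) g1))); ring.
have h2 : l2 = 2 * m.
  apply/eqP; rewrite -subr_eq0; apply/eqP; apply: (mulfI b0).
  by rewrite -g1 h1 subrr !mulr0.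
exists (g * l1 + h * l2); rewrite trilin2 e1 e2 e12 h1 h2.
by apply/rowP => k; rewrite !mxE; ring.
Qed.

End SymmetricTrilinear.

(** * Geometry of the residual eigenpoints *)

Section FiniteEigenscheme.
Variables (F : numFieldType) (N : 'rV[F]_3 -> 'rV[F]_3 -> 'rV[F]_3).
Hypothesis hN : sym_trilinear N.
Implicit Types p q t x y : 'rV[F]_3.

(* Polynomial curves of degree at most 2 are the only ones needed to exploit that
   the eigenscheme has dimension 0. *)
Hypothesis no_conic : forall x0 x1 x2,
  (forall w, eigenvec N (x0 + w *: x1 + w ^+ 2 *: x2)) -> x0 != 0 ->
  forall w, exists c, x0 + w *: x1 + w ^+ 2 *: x2 = c *: x0.

Lemma no_line x y t : ~ aligned x y t ->
  ~ (forall r s, eigenvec N (r *: x + s *: y)).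
Proof.
move=> nxyt line; have x0 : x != 0.
  apply/eqP => x0; have [|/eqP] := @nonaligned_free F x y t 1 0 0 0 0 0 nxyt.
    by rewrite x0 !scaler0 !scale0r.
  by rewrite oner_eq0.
have [w|c] := @no_conic x y 0 _ x0 1.
  by have := line 1 w; rewrite scale1r scaler0 addr0.
rewrite scaler0 addr0 => e.
have [|_ /eqP] := @nonaligned_free F x y t 1 1 0 c 0 0 nxyt.
  by rewrite !scale0r !addr0 -e !scale1r.
by rewrite oner_eq0.
Qed.

(** The exceptional case left by [nu_dichotomy]: the rank condition, in the form [uniq], is applied
    to the cubic composed with the orthogonal projection [pr] onto the span of p and q. *)
Lemma degenerate_nu p q t (a b c d l2 m n : F) :
  ~ aligned p q t ->
  (forall B, sym_trilinear B -> eigenvec B p -> eigenvec B q ->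
    eigenvec B (a *: p + b *: q) -> eigenvec B t -> eigenvec B (c *: p + d *: t) ->
    exists k, forall x, B x x = k *: N x x) ->
  eigenvec N (a *: p + b *: q) ->
  N p p = 0 -> N q q = l2 *: q -> N p q = m *: p + n *: q ->
  bil p p != 0 -> bil p p * bil q t = bil p q * bil p t -> n = 0.
Proof.
have [ND NZ NC Ns] := hN.
move=> npqt uniq [l3 e3] ep eq epq pp0 d1.
(* A normal vector to p and q lying on the line pt: orthogonal to p by construction, to q by
   [d1]. *)
have [v vE] : exists v, v = bil p p *: t + (- bil p t) *: p by eexists.
have bvp : bil p v = 0 by rewrite vE bilDr !bilZr; ring.
have bvq : bil q v = 0.
  by rewrite vE bilDr !bilZr (bilC q p); apply: (lincomb d1); ring.
have bvv : bil v v != 0.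
  apply/eqP => vv0.
  have bvt : bil v t = 0.
    have e : bil v v = bil p p * bil v t - bil p t * bil v p.
      by rewrite [X in bil v X]vE bilDr !bilZr mulNr.
    by apply: (mulfI pp0); rewrite mulr0 -vv0 e (bilC v p) bvp; ring.
  have v0 : v = 0.
    apply: bil_eq0 => z; have [r [s [u ->]]] := nonaligned_span z npqt.
    by rewrite !bilDr !bilZr (bilC v p) (bilC v q) bvp bvq bvt; ring.
  have [|_ _ /eqP] := @nonaligned_free F p q t (- bil p t) 0 (bil p p) 0 0 0 npqt.
    by rewrite !scale0r !addr0 -v0 vE addrC.
  by rewrite (negbTE pp0).
pose g x := bil x v / bil v v.
pose pr x := x - g x *: v.
have prE x : pr x = x + (- g x) *: v by rewrite scaleNr.
have prD x y : pr (x + y) = pr x + pr y.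
  by rewrite /pr /g bilDl; apply/rowP => k; rewrite !mxE; ring.
have prZ e x : pr (e *: x) = e *: pr x.
  by rewrite /pr /g bilZl; apply/rowP => k; rewrite !mxE; ring.
have prs x y : bil (pr x) y = bil x (pr y).
  by rewrite !prE /g bilDl bilDr bilZl bilZr (bilC v y); ring.
have prp : pr p = p by rewrite /pr /g bvp mul0r scale0r subr0.
have prq : pr q = q by rewrite /pr /g bvq mul0r scale0r subr0.
have prv : pr v = 0 by rewrite /pr /g divff // scale1r subrr.
(* On the line pt the projection collapses to p, where N vanishes; hence B vanishes on the whole
   line. *)
have [h prt] : exists h, pr t = h *: p.
  exists (bil p t / bil p p).
  have tE : t = (bil p p)^-1 *: v + (bil p t / bil p p) *: p.
    by rewrite vE; apply/rowP => k; rewrite !mxE; field.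
  by rewrite {1}tE prD !prZ prv prp scaler0 add0r.
(* B polarises the gradient of the composite of f with the projection pr. *)
pose B x y := pr (N (pr x) (pr y)).
have hB : sym_trilinear B.
  split=> [x y z|e x z|x y|x y z].
  - by rewrite /B !prD ND prD.
  - by rewrite /B !prZ NZ prZ.
  - by rewrite /B NC.
  - by rewrite /B !prs Ns -!prs.
have Bpt r s : B (r *: p + s *: t) (r *: p + s *: t) = 0.
  rewrite /B !prD !prZ prp prt scalerA -scalerDl NZ NC NZ ep !scaler0.
  by have := prZ 0 0; rewrite !scale0r.
have prL r s : pr (r *: p + s *: q) = r *: p + s *: q by rewrite prD !prZ prp prq.
have BL r s z : N (r *: p + s *: q) (r *: p + s *: q) = z *: (r *: p + s *: q) ->
    eigenvec B (r *: p + s *: q).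
  by move=> e; exists z; rewrite /B prL e prZ prL.
have [||||| k Bk] := uniq B hB.
- by exists 0; have := Bpt 1 0; rewrite scale1r scale0r addr0 scale0r.
- have := @BL 0 1 l2; rewrite scale0r scale1r add0r; exact.
- exact: BL e3.
- by exists 0; have := Bpt 0 1; rewrite scale1r !scale0r add0r.
- by exists 0; rewrite Bpt scale0r.
(* For nonzero [k], N would vanish along the line pt as B does. For [k] = 0, B(p, q) = 0, and this
   is N(p, q) because [pr] fixes p and q. *)
have [k0|k0] := eqVneq k 0; last first.
  have nptq : ~ aligned p t q by case=> w [? ? ? ?]; apply: npqt; exists w.
  case: (no_line nptq) => r s; exists 0; rewrite scale0r.
  by apply/(scalerI k0); rewrite -Bk Bpt scaler0.
have Bpq : B p q = 0.
  have := trilin2 hB 1 1 p q; rewrite !Bk k0 !scale0r !scaler0 add0r addr0.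
  move=> /esym/eqP; rewrite scaler_eq0 => /orP[|/eqP //].
  by rewrite !mulr1 Num.Theory.pnatr_eq0.
have [|_ -> //] := @nonaligned_free F p q t m n 0 0 0 0 npqt.
by rewrite !scale0r !addr0 -epq -Bpq /B prp prq epq prL.
Qed.


(* Otherwise N(x, x) = A x *: p + w x *: x for a quadratic form A vanishing at q
   and t, and the conic A = 0 is parametrised by the lines through q. *)
Lemma third_line_neq0 p q t (l1 l2 l4 m n m' k r s : F) : ~ aligned p q t ->
  N p p = l1 *: p -> N q q = l2 *: q -> N t t = l4 *: t ->
  N p q = m *: p + n *: q -> N p t = m' *: p + n *: t ->
  N q t = k *: p + r *: q + s *: t ->
  ~ (l2 = 2 * s /\ l4 = 2 * r).
Proof.
move=> npqt e1 e2 e4 e12 e14 e24 [l2E l4E].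
pose al := l1 - 2 * n; pose b1 := 2 * m - l2; pose b2 := 2 * m' - l4.
have [k0|k0] := eqVneq k 0.
  have nqtp : ~ aligned q t p by case=> w [? ? ? ?]; apply: npqt; exists w.
  apply: (no_line nqtp) => x y; exists (x * l2 + y * l4).
  rewrite (trilin2 hN) e2 e4 e24 k0 l2E l4E.
  by apply/rowP => i; rewrite !mxE; ring.
(* In coordinates (y, z, u) the conic is [al] y^2 + [b1] y z + [b2] y u + 2 [k] z u = 0. The
   parameter w stands for the line y = w u through q, and w = 0 yields t. *)
pose x0 := (2 * k) *: t; pose x1 := (2 * k) *: p - b2 *: q + b1 *: t.
pose x2 := b1 *: p - al *: q.
have XE w : x0 + w *: x1 + w ^+ 2 *: x2 = (w * (b1 * w + 2 * k)) *: p
    + (- (al * w ^+ 2 + b2 * w)) *: q + (b1 * w + 2 * k) *: t.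
  by apply/rowP => i; rewrite !mxE; ring.
have X w : eigenvec N (x0 + w *: x1 + w ^+ 2 *: x2).
  exists (2 * (w * (b1 * w + 2 * k)) * n - (al * w ^+ 2 + b2 * w) * l2
    + (b1 * w + 2 * k) * l4).
  rewrite XE (trilin3 hN) e1 e2 e4 e12 e14 e24 /al /b1 /b2 l2E l4E.
  by apply/rowP => i; rewrite !mxE; ring.
have k2 : 2 * k != 0 by rewrite mulf_neq0 // Num.Theory.pnatr_eq0.
have x00 : x0 != 0.
  apply/eqP => x00; have [|_ _ /eqP] := @nonaligned_free F p q t 0 0 (2 * k) 0 0 0 npqt.
    by rewrite !scale0r !add0r.
  by rewrite (negbTE k2).
have Z w : w * (b1 * w + 2 * k) = 0.
  have [c] := no_conic X x00 w; rewrite XE /x0 scalerA => e.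
  have [|-> //] := @nonaligned_free F p q t (w * (b1 * w + 2 * k))
    (- (al * w ^+ 2 + b2 * w)) (b1 * w + 2 * k) 0 0 (c * (2 * k)) npqt.
  by rewrite e !scale0r !add0r.
have /eqP : 2 * (2 * k) = 0.
  by apply: (lincomb (eqD (Z 1) (eqM (-1) (Z (-1))))); ring.
by rewrite mulf_eq0 (negbTE k2) Num.Theory.pnatr_eq0.
Qed.

(* In the coordinates (y, z, u) on the basis p, q, t, the cubic
   det (p, x, N(x, x)) is z u (z (l2 - 2 s) - u (l4 - 2 r)) up to a constant. *)
Lemma eigenvec_third_line p q t (l1 l2 l4 m n m' k r s y z u : F) :
  ~ aligned p q t ->
  N p p = l1 *: p -> N q q = l2 *: q -> N t t = l4 *: t ->
  N p q = m *: p + n *: q -> N p t = m' *: p + n *: t ->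
  N q t = k *: p + r *: q + s *: t ->
  eigenvec N (y *: p + z *: q + u *: t) -> z != 0 -> u != 0 ->
  z * (l2 - 2 * s) = u * (l4 - 2 * r).
Proof.
move=> npqt e1 e2 e4 e12 e14 e24 [l]; rewrite (trilin3 hN) e1 e2 e4 e12 e14 e24.
move=> E z0 u0.
have [|_ f g] := @nonaligned_free F p q t
  (y ^+ 2 * l1 + 2 * y * z * m + 2 * y * u * m' + 2 * z * u * k)
  (z * (z * l2 + 2 * y * n + 2 * u * r)) (u * (u * l4 + 2 * y * n + 2 * z * s))
  (l * y) (z * l) (u * l) npqt.
  move/rowP: E => E; apply/rowP => i; move: (E i); rewrite !mxE => Ei.
  by apply: (lincomb Ei); ring.
(* The terms in y cancel because [N p q] and [N p t] have the same coefficient [n]. *)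
move: f g => /(mulfI z0) f /(mulfI u0) g.
by apply: (lincomb (etrans f (esym g))); ring.
Qed.

(** The third and fifth points are replaced by their coordinates on p, q and on p, t; [uniq] stands
    for the rank condition. *)
Lemma aligned_residual p q t x y (a b c d : F) :
  ~ aligned p q t -> a != 0 -> b != 0 -> c != 0 -> d != 0 ->
  (forall B, sym_trilinear B -> eigenvec B p -> eigenvec B q ->
    eigenvec B (a *: p + b *: q) -> eigenvec B t -> eigenvec B (c *: p + d *: t) ->
    exists k, forall x, B x x = k *: N x x) ->
  eigenvec N p -> eigenvec N q -> eigenvec N (a *: p + b *: q) ->
  eigenvec N t -> eigenvec N (c *: p + d *: t) ->
  bil p q * bil p (a *: p + b *: q) * bil t (c *: p + d *: t) =
    bil p t * bil p (c *: p + d *: t) * bil q (a *: p + b *: q) ->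
  (forall z, z \in [:: x; y] -> eigenvec N z /\
     forall e, [/\ z <> e *: p, z <> e *: q, z <> e *: (a *: p + b *: q),
       z <> e *: t & z <> e *: (c *: p + d *: t)]) ->
  aligned p x y.
Proof.
have [_ _ NC Ns] := hN.
move=> npqt a0 b0 c0 d0 uniq ep eq e3 et e5 D xy.
have nptq : ~ aligned p t q by case=> w [? ? ? ?]; apply: npqt; exists w.
have uniq' B : sym_trilinear B -> eigenvec B p -> eigenvec B t ->
    eigenvec B (c *: p + d *: t) -> eigenvec B q -> eigenvec B (a *: p + b *: q) ->
    exists k, forall x, B x x = k *: N x x.
  by move=> *; apply: uniq.
have [l1 ep'] := ep; have [l2 eq'] := eq; have [l4 et'] := et.
have [l3 e3'] := e3; have [l5 e5'] := e5.
have [m [n [epq f1 f2]]] := eigen_line hN a0 b0 ep' eq' e3'.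
have [m' [n' [ept f1' f2']]] := eigen_line hN c0 d0 ep' et' e5'.
have [r1 r2] := eigen_line_rel hN ep' eq' epq f1 f2.
have [r1' r2'] := eigen_line_rel hN ep' et' ept f1' f2'.
have rs : m * bil p t + n * bil q t = m' * bil p q + n' * bil q t.
  by have := Ns p q t; rewrite epq ept !(bilZl, bilDl) (bilC t q).
have nn : n = n'.
  apply/eqP/negPn/negP => nn.
  have G0 := gram_neq0 npqt.
  have D' := D; rewrite !(bilDr, bilZr) (bilC t p) (bilC q p) in D'.
  have [pp0 l10 d1] := nu_dichotomy b0 d0 G0 r1 r1' r2 r2' rs D' nn.
  rewrite l10 scale0r in ep'.
  move: nn; rewrite (degenerate_nu npqt uniq e3 ep' eq' epq pp0 d1).
  by rewrite (degenerate_nu nptq uniq' e5 ep' et' ept pp0) ?eqxx // (bilC t) d1 mulrC.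
rewrite -{n'}nn in ept f2' r1' r2' rs.
have [k [r [s eqt]]] := nonaligned_span (N q t) npqt.
(* On either line through p, such a point would be a fourth eigenpoint and make the whole line
   consist of eigenpoints. *)
have off z : z \in [:: x; y] -> exists g h u,
    [/\ z = g *: p + h *: q + u *: t, h != 0, u != 0
      & h * (l2 - 2 * s) = u * (l4 - 2 * r)].
  move=> /xy[ez nz]; have [g [h [u zE]]] := nonaligned_span z npqt.
  have [h0|h0] := eqVneq h 0.
    case: (no_line nptq); rewrite zE h0 scale0r addr0 in ez nz.
    apply: (four_eigen_line hN nptq c0 d0 _ _ _ ep' et' e5' ez).
    - by apply/eqP => g0; case: (nz u); rewrite g0 scale0r add0r.
    - by apply/eqP => u0; case: (nz g); rewrite u0 scale0r addr0.
    - apply/eqP => gd; case: (nz (u / d)) => _ _ _ _; apply.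
      have -> : g = u * c / d by rewrite -gd mulfK.
      by apply/rowP => i; rewrite !mxE; field.
  have [u0|u0] := eqVneq u 0.
    case: (no_line npqt); rewrite zE u0 scale0r addr0 in ez nz.
    apply: (four_eigen_line hN npqt a0 b0 _ _ _ ep' eq' e3' ez).
    - by apply/eqP => g0; case: (nz h); rewrite g0 scale0r add0r.
    - by apply/eqP => h00; case: (nz g); rewrite h00 scale0r addr0.
    - apply/eqP => gb; case: (nz (h / b)) => _ _; case.
      have -> : g = h * a / b by rewrite -gb mulfK.
      by apply/rowP => i; rewrite !mxE; field.
  exists g, h, u; split=> //.
  rewrite zE in ez.
  exact: (eigenvec_third_line npqt ep' eq' et' epq ept eqt ez h0 u0).
have [g [h [u [xE h0 u0 xe]]]] := off x (mem_head _ _).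
have yin : y \in [:: x; y] by rewrite !inE eqxx orbT.
have [g' [h' [u' [yE h0' u0' ye]]]] := off y yin.
(* Both pairs solve the same linear equation, which is nonzero by [third_line_neq0]. *)
have hu : h * u' = h' * u.
  apply/eqP; rewrite -subr_eq0; apply/negPn/negP => hu.
  apply: (third_line_neq0 npqt ep' eq' et' epq ept eqt).
  split; apply/eqP; rewrite -subr_eq0; apply/eqP; apply: (mulfI hu).
    by apply: (lincomb (eqD (eqM u' xe) (eqM (- u) ye))); ring.
  by apply: (lincomb (eqD (eqM h' xe) (eqM (- h) ye))); ring.
(* By [hu], the combination [h' *: x - h *: y] has no component along q or t. *)
apply: (@aligned_dep F p x y (h * g' - h' * g) h' (- h)).
  by rewrite oppr_eq0.
apply/rowP => i; rewrite xE yE !mxE.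
by apply: (lincomb (eqM (- t 0 i) hu)); ring.
Qed.

End FiniteEigenscheme.

(** * Return to cubic forms and to the rank condition *)

Lemma ord3P (P : 'I_3 -> Prop) : P ix -> P iy -> P iz -> forall k, P k.
Proof.
by move=> P0 P1 P2 [[|[|[|//]]] hk]; [move: P0|move: P1|move: P2];
  congr P; apply: val_inj.
Qed.

Lemma eigenform_eq0P (F : fieldType) (f : {mpoly F[3]}) (x : 'rV[F]_3) :
  (forall k, (eigenform f k).@[x 0] = 0) <->
  (forall i j, x 0 i * grad f x 0 j = x 0 j * grad f x 0 i).
Proof.
pose g i := grad f x 0 i.
have gE i : (f^`M(i)).@[x 0] = g i by rewrite /g mxE.
have E : [/\ (eigenform f ix).@[x 0] = x 0 ix * g iy - x 0 iy * g ix,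
   (eigenform f iy).@[x 0] = x 0 ix * g iz - x 0 iz * g ix
   & (eigenform f iz).@[x 0] = x 0 iy * g iz - x 0 iz * g iy].
  by split; rewrite /eigenform (tnth_nth 0) /= mevalB !mevalM !mevalXU !gE.
have [E1 E2 E3] := E.
split=> H; last by apply: ord3P; rewrite ?E1 ?E2 ?E3 /g H subrr.
have := (H ix, H iy, H iz); rewrite E1 E2 E3 => -[[/subr0_eq h1 /subr0_eq h2] /subr0_eq h3].
by apply: ord3P; apply: ord3P; rewrite -!/(g _).
Qed.

Lemma eigenpoint_eigenvec (F : fieldType) (f : {mpoly F[3]}) N (x : 'rV[F]_3) :
  (forall x, grad f x = N x x) -> eigenpoint f x -> eigenvec N x.
Proof.
move=> fN [x0 /eigenform_eq0P h]; have [c] := minors_eq0 x0 h.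
by rewrite fN => e; exists c.
Qed.

Lemma eigenvec_eigenform (F : fieldType) (f : {mpoly F[3]}) N (x : 'rV[F]_3) k :
  (forall x, grad f x = N x x) -> eigenvec N x -> (eigenform f k).@[x 0] = 0.
Proof.
move=> fN [c e]; move: k; apply/eigenform_eq0P => i j.
by rewrite fN e !mxE; ring.
Qed.

(** This discharges [no_conic], reading the coordinates of the curve as polynomials in w. *)
Lemma eigenconic_constant (F : numFieldType) (f : {mpoly F[3]}) N :
  f \is 3.-homog -> eigenscheme_dim0 f -> (forall x, grad f x = N x x) ->
  forall x0 x1 x2 : 'rV[F]_3,
  (forall w, eigenvec N (x0 + w *: x1 + w ^+ 2 *: x2)) -> x0 != 0 ->
  forall w, exists c, x0 + w *: x1 + w ^+ 2 *: x2 = c *: x0.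
Proof.
move=> fh dim0 fN x0 x1 x2 ev x00 w; apply: minors_eq0 => //.
pose X j := (x0 0 j)%:P + x1 0 j *: 'X + x2 0 j *: 'X^2.
have XE v j : (X j).[v] = (x0 + v *: x1 + v ^+ 2 *: x2) 0 j.
  rewrite !hornerD !hornerZ hornerC hornerXn hornerX !mxE.
  by rewrite (mulrC v) (mulrC (v ^+ 2)).
have X0 j : (X j).[0] = x0 0 j.
  by rewrite XE scale0r expr0n /= scale0r !addr0.
have eX v k : (eigenform f k).@[fun j => (X j).[v]] = 0.
  by rewrite (meval_eq _ (XE v)) (eigenvec_eigenform k fN (ev v)).
move=> i j; have := eigencurve_constant fh dim0 eX 0 w i j.
by rewrite !X0 !XE.
Qed.

Lemma corank1_ker (F : fieldType) (m n : nat) (A : 'M[F]_(m, n.+1))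
    (v w : 'cV[F]_n.+1) :
  \rank A = n -> v != 0 -> A *m v = 0 -> A *m w = 0 -> exists c, w = c *: v.
Proof.
move=> rA v0 Av Aw; pose K := kermx A^T.
have rK : \rank K = 1%N by rewrite mxrank_ker mxrank_tr rA subSnn.
have inK (u : 'cV[F]_n.+1) : A *m u = 0 -> (u^T <= K)%MS.
  by move=> Au; apply/sub_kermxP; rewrite -trmx_mul Au trmx0.
have v0' : v^T != 0 by apply: contraNneq v0 => e; rewrite -(trmxK v) e trmx0.
have Kv : (K <= v^T)%MS.
  by rewrite -(mxrank_leqif_sup (inK v Av)) rK rank_rV v0'.
have /sub_rVP[c e] := submx_trans (inK w Aw) Kv.
by exists c; rewrite -[w]trmxK e linearZ /= trmxK.
Qed.

Lemma Phi_stack_ker (F : fieldType) (n : nat) (P : n.-tuple 'rV[F]_3)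
    (f : {mpoly F[3]}) :
  f \is 3.-homog -> (forall x, x \in P -> forall k, (eigenform f k).@[x 0] = 0) ->
  Phi_stack P *m cubic_coefs f = 0.
Proof.
move=> fh fP; rewrite /Phi_stack mxcol_mul -[RHS]mxcol0; apply: eq_mxcol => i.
by rewrite PhiE //; apply/colP => k; rewrite !mxE fP // mem_tnth.
Qed.

Lemma cubic_coefs_inj (F : fieldType) (c : F) (f g : {mpoly F[3]}) :
  f \is 3.-homog -> g \is 3.-homog ->
  cubic_coefs g = c *: cubic_coefs f -> g = c *: f.
Proof.
move=> fh gh /colP e; rewrite (cubicE fh) (cubicE gh) scaler_sumr.
by apply: eq_bigr => j _; move: (e j); rewrite !mxE => ->; rewrite scalerA.
Qed.

Lemma not_same_pointP (F : fieldType) (x y : 'rV[F]_3) (c : F) :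
  x != 0 -> ~~ same_point x y -> x <> c *: y.
Proof.
move=> x0 + e; rewrite /same_point e => /negP; apply.
have c0 : c != 0 by apply: contraNneq x0 => c0; rewrite e c0 scale0r.
by apply/andP; rewrite !(eqmx_scale _ c0).
Qed.

Lemma aligned_comb (F : fieldType) (p q t x : 'rV[F]_3) :
  ~ aligned p q t -> aligned p q x -> exists a b, x = a *: p + b *: q.
Proof.
move=> npqt [l [l0 pl ql xl]]; have [a [b [c e]]] := nonaligned_span x npqt.
exists a, b; have [c0|c0] := eqVneq c 0; first by rewrite e c0 scale0r addr0.
case: npqt; exists l; split=> //; apply: (scalerI c0); rewrite scaler0 -xl e.
by rewrite !mulmxDl -!scalemxAl pl ql !scaler0 !add0r.
Qed.

Lemma V_configuration_residual (F : numFieldType) (P1 P2 P3 P4 P5 : 'rV[F]_3)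
    (f : {mpoly F[3]}) (Q1 Q2 : 'rV[F]_3) :
  V_configuration P1 P2 P3 P4 P5 ->
  \rank (Phi_stack [tuple P1; P2; P3; P4; P5]) = 9%N ->
  delta2 P1 P2 P3 P4 P5 = 0 ->
  f != 0 -> f \is 3.-homog ->
  (forall P, P \in [:: P1; P2; P3; P4; P5] -> eigenpoint f P) ->
  eigenscheme_dim0 f ->
  eigenpoint f Q1 -> eigenpoint f Q2 ->
  (forall P, P \in [:: P1; P2; P3; P4; P5] ->
     ~~ same_point Q1 P && ~~ same_point Q2 P) ->
  aligned P1 Q1 Q2.
Proof.
move=> [nz pw al1 al2 nal] rk D f0 fh ev dim0 eQ1 eQ2 QP.
move: nz => /= /and5P[P10 P20 P30 P40 /andP[P50 _]].
move: pw => /= /and5P[/and5P[_ n13 _ n15 _] /and4P[n23 _ _ _] _ /andP[n45 _] _].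
have [T [T12 T23 fT]] := grad_tens fh.
have hN : sym_trilinear (tens T).
  split=> *; [exact: tensDl|exact: tensZl|exact: tensC|exact: bil_tens].
have eN x : x \in [:: P1; P2; P3; P4; P5] -> eigenvec (tens T) x.
  by move=> /ev; apply: eigenpoint_eigenvec.
have nal' : ~ aligned P1 P4 P2 by case=> w [? ? ? ?]; apply: nal; exists w.
have [a [b P3E]] := aligned_comb nal al1.
have [c [d P5E]] := aligned_comb nal' al2.
have nspC (x y : 'rV[F]_3) : ~~ same_point x y -> ~~ same_point y x.
  by apply: contra; rewrite /same_point andbC.
(* A zero coefficient would identify two of the five distinct points. *)
have coef0 (x y z : 'rV[F]_3) r s : z != 0 -> ~~ same_point x z -> ~~ same_point y z ->
    z = r *: x + s *: y -> r != 0 /\ s != 0.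
  move=> z0 /nspC xz /nspC yz zE; split; apply/eqP => e; rewrite e in zE.
    by apply: (not_same_pointP (c := s) z0 yz); rewrite zE scale0r add0r.
  by apply: (not_same_pointP (c := r) z0 xz); rewrite zE scale0r addr0.
have [a0 b0] := coef0 _ _ _ _ _ P30 n13 n23 P3E.
have [c0 d0] := coef0 _ _ _ _ _ P50 n15 n45 P5E.
have Pin : [/\ P1 \in [:: P1; P2; P3; P4; P5], P2 \in [:: P1; P2; P3; P4; P5],
    P3 \in [:: P1; P2; P3; P4; P5], P4 \in [:: P1; P2; P3; P4; P5]
    & P5 \in [:: P1; P2; P3; P4; P5]] by split; rewrite !inE eqxx ?orbT.
have [i1 i2 i3 i4 i5] := Pin.
apply: (aligned_residual hN (eigenconic_constant fh dim0 fT) nal a0 b0 c0 d0);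
  rewrite -?P3E -?P5E; try exact: eN.
(* B comes from a cubic g whose coefficients lie in the kernel of the stacked matrix. Rank 9 out of
   10 columns leaves only the multiples of those of f. *)
- move=> B hB B1 B2 B3 B4 B5; have [BD BZ BC Bs] := hB.
  have [T' [T'12 T'23 BE]] := bilinear_tens BD BZ BC Bs.
  have [g gh gT] := tens_grad T'12 T'23.
  have gB x : grad g x = B x x by rewrite gT BE.
  have kf : Phi_stack [tuple P1; P2; P3; P4; P5] *m cubic_coefs f = 0.
    by apply: Phi_stack_ker fh _ => x xP; case: (ev x xP).
  have kg : Phi_stack [tuple P1; P2; P3; P4; P5] *m cubic_coefs g = 0.
    apply: Phi_stack_ker gh _ => x xP k; apply: (eigenvec_eigenform k gB).
    by move: xP; rewrite !inE => /or4P[||| /orP[]] /eqP ->.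
  have cf0 : cubic_coefs f != 0.
    apply: contraNneq f0 => cf0; rewrite -(scale0r f); apply/eqP.
    by apply: cubic_coefs_inj => //; rewrite cf0 scaler0.
  have [k e] := corank1_ker rk cf0 kf kg; exists k => x.
  rewrite -gB -fT (cubic_coefs_inj fh gh e).
  by apply/rowP => i; rewrite !mxE mderivZ mevalZ.
- by apply/eqP; rewrite -subr_eq0; apply/eqP.
- move=> z zQ.
  have [ez zP] : eigenpoint f z /\
      forall P, P \in [:: P1; P2; P3; P4; P5] -> ~~ same_point z P.
    by move: zQ; rewrite !inE => /orP[] /eqP ->; split=> // P /QP /andP[].
  have [z0 _] := ez; split; first exact: eigenpoint_eigenvec ez.
  by move=> e; split; apply: (not_same_pointP z0); apply: zP.
Qed.

Theorem proposition4p4 (R : realType) (P1 P2 P3 P4 P5 : 'rV[R[i]]_3)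
    (f : {mpoly R[i][3]}) :
  V_configuration P1 P2 P3 P4 P5 ->
  \rank (Phi_stack [tuple P1; P2; P3; P4; P5]) = 9%N ->
  delta2 P1 P2 P3 P4 P5 = 0 ->
  f != 0 -> f \is 3.-homog ->
  (forall P, P \in [:: P1; P2; P3; P4; P5] -> eigenpoint f P) ->
  regular_eigenscheme f ->
  forall Q1 Q2 : 'rV[R[i]]_3,
    eigenpoint f Q1 -> eigenpoint f Q2 -> ~~ same_point Q1 Q2 ->
    (forall P, P \in [:: P1; P2; P3; P4; P5] ->
       ~~ same_point Q1 P && ~~ same_point Q2 P) ->
    aligned P1 Q1 Q2.
Proof.
move=> V rk D f0 fh ev [_ dim0] Q1 Q2 eQ1 eQ2 _ QP.
exact: (V_configuration_residual V rk D f0 fh ev dim0 eQ1 eQ2 QP).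
Qed.
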